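(* There is a universal constant $C$ such that the following holds. Let $f:\{0,1\}^n\to\{0,1\}$ be computed by a width-3, read-once, oblivious branching program of length $n$. Then for all $k\in[n]$, $$L^k(f):=\sum_{s\subseteq[n]:|s|=k}|\widehat f[s]|\le 8n^2\cdot\left(C\cdot\log_2(3n)\right)^k .$$
   Context: For $f:\{0,1\}^n\to\mathbb{R}$ and $s\subseteq[n]$, $\widehat f[s]=\mathbb{E}_U[f(U)(-1)^{\sum_{i\in s}U_i}]$ with $U$ uniform on $\{0,1\}^n$. A length-$n$, width-$w$ ordered branching program has layers of vertices $V_0,\dots,V_n$ with $|V_i|\le w$ and transition maps $T_i:V_{i-1}\times\{0,1\}\to V_i$; on input $x$ it starts at a fixed $u_0\in V_0$ and follows $T_i(\cdot,x_i)$ for $i=1,\dots,n$; it computes $f$ if for some $S\subseteq V_n$, $f(x)=1$ iff the final vertex lies in $S$. A read-once, oblivious branching program computes $x\mapsto f'(\pi(x))$ where $f'$ is computed by an ordered branching program and $\pi$ is a permutation of the coordinates. *)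

(* Defs.v *)
From HB Require Import structures.
From mathcomp Require Import all_boot all_order all_fingroup all_algebra.
From mathcomp Require Import reals exp.

Set Implicit Arguments.
Unset Strict Implicit.
Unset Printing Implicit Defensive.

Import GRing.Theory Num.Theory.
Local Open Scope ring_scope.

(* Coordinates [n] = {1, ..., n} are represented by 'I_n = {0, ..., n-1}. *)
Notation cube n := {ffun 'I_n -> bool}.

Definition unif_expectation (R : realType) (n : nat) (g : cube n -> R) : R :=
  (\sum_(U : cube n) g U) / #|{: cube n}|%:R.

Definition fourier (R : realType) (n : nat) (f : cube n -> R)
    (s : {set 'I_n}) : R :=
  unif_expectation (fun U => f U * (-1) ^+ (\sum_(i in s) (U i : nat))%N).

Definition fourier_weight (R : realType) (n k : nat) (f : cube n -> R) : R :=
  \sum_(s : {set 'I_n} | #|s| == k) `|fourier f s|.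

Definition log2 (R : realType) (x : R) : R := ln x / ln 2.

(* Only the layers 0, ..., n are meaningful; indexing the layers by nat rather
   than 'I_n.+1 avoids casts, and the values beyond n are never used.
   For i : 'I_n, bp_trans i reads coordinate i and goes from V_i to V_(i+1). *)
Record ordered_bp (n w : nat) := OrderedBP {
  bp_layer : nat -> finType;
  bp_width : forall i : nat, (i <= n)%N -> (#|bp_layer i| <= w)%N;
  bp_trans : forall i : 'I_n, bp_layer i -> bool -> bp_layer i.+1;
  bp_start : bp_layer 0
}.

(* The vertex of layer m reached on input x; m < n below is m.+1 <= n. *)
Fixpoint bp_state (n w : nat) (B : ordered_bp n w) (x : cube n) (m : nat) :
    (m <= n)%N -> bp_layer B m :=
  match m return (m <= n)%N -> bp_layer B m with
  | 0 => fun _ => bp_start B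
  | m'.+1 => fun lt_m'n =>
      @bp_trans n w B (Ordinal lt_m'n)
        (bp_state B x (ltnW lt_m'n)) (x (Ordinal lt_m'n))
  end.

Definition bp_final (n w : nat) (B : ordered_bp n w) (x : cube n) :
    bp_layer B n := bp_state B x (leqnn n).

Definition bp_computes (n w : nat) (B : ordered_bp n w) (f : cube n -> bool) :=
  exists S : {set bp_layer B n}, forall x : cube n, f x = (bp_final B x \in S).

Definition permute_coords (n : nat) (pi : 'S_n) (x : cube n) : cube n :=
  [ffun i => x (pi i)].

Definition computed_by_robp (n w : nat) (f : cube n -> bool) : Prop :=
  exists (f' : cube n -> bool) (pi : 'S_n),
    (exists B : ordered_bp n w, bp_computes B f') /\
    (forall x : cube n, f x = f' (permute_coords pi x)).

(* Main.v *)
Require Import Defs.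
From mathcomp Require Import all_boot all_order all_fingroup all_algebra.
From mathcomp Require Import reals exp.
From mathcomp Require Import boolp ring lra.

Set Implicit Arguments.
Unset Strict Implicit.
Unset Printing Implicit Defensive.

Import Order.TTheory GRing.Theory Num.Theory.
Local Open Scope ring_scope.

(* With M_i(b) the transition matrix of layer i on bit b, the Fourier
   coefficient at s is an entry of the product of the matrices
   (M_i(0) + M_i(1))/2 (i outside s) and (M_i(0) - M_i(1))/2 (i in s).  Weighting
   coefficient s by t^|s| turns sums of seminorms over all s into iterates of the
   positive operator N |-> N(avg y) + t N(hdiff y), applied layer after layer.

   For y with values in [0, 1], the total weight of |y_p - y_q| over nonempty s is
   at most K (1 - |E y_p - E y_q|).  A single layer increases K to (1 + O(t)) K + O(t),
   and a whole block of layers permuting the three states does no worse, because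
   there both the spread of y and the pair distances padded by 2t times the
   spread contract.  So K <= 1 up to about 1/t non-permutation layers.

   A random restriction turns each non-permutation layer, with probability at
   least 1/4, into a fixed non-injective map.  Its image has at most two states, so
   the vectors crossing it are multiples of a single 0/1 vector modulo constants,
   and the bounds for consecutive blocks multiply.  As K <= 1 unless a block has
   more than order log n non-permutation layers, which has probability below 1/n,
   the expected product is bounded for t of order 1/log n.  Restricting with
   survival probability at least 1/2 costs only 2^k at level k. *)

(* Any type with three elements and decidable equality would do. *)
Notation state := (option bool).
Notation layer := (bool -> state -> state).

Definition perm_layer (l : layer) := injectiveb (l false) && injectiveb (l true).

Definition const_layer (T : state -> state) : layer := fun=> T.

(** * Weighted sums over layers, and distances between three states *)

Section Functionals.

Variable R : realFieldType.

Notation vec := (state -> R).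
Notation functional := (vec -> R).

Implicit Types (l : layer) (D L P : seq layer) (t : R) (y : vec) (N : functional).

Definition avg l y : vec := fun p => (y (l false p) + y (l true p)) / 2.
Definition hdiff l y : vec := fun p => (y (l false p) - y (l true p)) / 2.

Definition avgs D y : vec := foldr avg y D.

Definition monotone_op (op : layer -> functional -> functional) :=
  forall l N N', (forall y, N y <= N' y) -> forall y, op l N y <= op l N' y.

Definition linear_op (op : layer -> functional -> functional) :=
  forall l (c c' : R) N N',
    op l (fun y => c * N y + c' * N' y) = fun y => c * op l N y + c' * op l N' y.

(* The first layer of the list acts first: it is the leftmost factor of the matrix
   product, hence the last one to be applied to the vector. *)
Definition run_op (op : layer -> functional -> functional) D N : functional :=
  foldl (fun N l => op l N) N D.

Lemma run_op_cons op l D N : run_op op (l :: D) N = run_op op D (op l N).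
Proof. by []. Qed.

Lemma run_op_cat op D D' N : run_op op (D ++ D') N = run_op op D' (run_op op D N).
Proof. exact: foldl_cat. Qed.

Lemma run_op_rcons op D l N : run_op op (rcons D l) N = op l (run_op op D N).
Proof. by rewrite -cats1 run_op_cat. Qed.

Lemma run_op_le op D N N' : monotone_op op ->
  (forall y, N y <= N' y) -> forall y, run_op op D N y <= run_op op D N' y.
Proof.
move=> opM; elim: D N N' => [|l D IH] N N' leN y; first by rewrite /run_op /=; apply: leN.
by apply: IH => {}y; apply: opM.
Qed.

Lemma run_op_lin op D c c' N N' : linear_op op ->
  run_op op D (fun y => c * N y + c' * N' y) =
  fun y => c * run_op op D N y + c' * run_op op D N' y.
Proof.
by move=> opL; elim: D N N' => [|l D IH] N N' //; rewrite !run_op_cons opL IH.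
Qed.

Lemma run_op_scale op D c N : linear_op op ->
  run_op op D (fun y => c * N y) = fun y => c * run_op op D N y.
Proof.
move=> opL; have := run_op_lin D c 0 N N opL.
have -> : (fun y => c * N y + 0 * N y) = (fun y => c * N y).
  by apply/funext => y; rewrite mul0r addr0.
by move=> ->; apply/funext => y; rewrite mul0r addr0.
Qed.

Definition wstep t l N : functional := fun y => N (avg l y) + t * N (hdiff l y).

Notation wsum t := (run_op (wstep t)).

(* The part of [wsum t D N y] coming from nonempty s; see [wsumE]. *)
Fixpoint wsum_pos t D N y :=
  if D is l :: D' then wsum_pos t D' (wstep t l N) y + t * N (hdiff l (avgs D' y))
  else 0.

Lemma wstep_monotone t : 0 <= t -> monotone_op (wstep t).
Proof. by move=> t0 l N N' leN y; apply: lerD; rewrite ?ler_wpM2l. Qed.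

Lemma wstep_linear t : linear_op (wstep t).
Proof. by move=> l c c' N N'; apply/funext => y; rewrite /wstep; ring. Qed.

Lemma wsumE t D N y : wsum t D N y = N (avgs D y) + wsum_pos t D N y.
Proof.
elim: D N => [|l D IH] N; first by rewrite /= addr0.
by rewrite run_op_cons IH /= /wstep; ring.
Qed.

Lemma wsum_pos_le t D N N' y : 0 <= t -> (forall y, N y <= N' y) ->
  wsum_pos t D N y <= wsum_pos t D N' y.
Proof.
move=> t0; elim: D N N' => [|l D IH] N N' leN //=.
by apply: lerD; [apply: IH; apply: wstep_monotone | rewrite ler_wpM2l].
Qed.

Lemma wsum_pos_lin t D c c' N N' y :
  wsum_pos t D (fun y => c * N y + c' * N' y) y =
  c * wsum_pos t D N y + c' * wsum_pos t D N' y.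
Proof.
elim: D N N' => [|l D IH] N N' /=; first by rewrite !mulr0 addr0.
by rewrite wstep_linear IH; ring.
Qed.

Lemma wsum_pos_scale t D c N y :
  wsum_pos t D (fun y => c * N y) y = c * wsum_pos t D N y.
Proof.
have -> : (fun y => c * N y) = (fun y => c * N y + 0 * N y).
  by apply/funext => z; rewrite mul0r addr0.
by rewrite wsum_pos_lin mul0r addr0.
Qed.

(** A nonempty s either meets [D'] and is arbitrary on [D], or lies within [D], so that [D'] only
    averages. *)
Lemma wsum_pos_cat t D D' N y :
  wsum_pos t (D ++ D') N y =
  wsum_pos t D' (wsum t D N) y + wsum_pos t D N (avgs D' y).
Proof.
elim: D N => [|l D IH] N /=; first by rewrite addr0.
by rewrite IH -addrA /avgs foldr_cat.
Qed.

Definition gap p q : functional := fun y => `|y p - y q|.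

(** Twice the difference between the largest and the smallest value. *)
Definition spread : functional := fun y =>
  gap None (Some false) y + gap None (Some true) y + gap (Some false) (Some true) y.

Definition unit_vec y := forall p, 0 <= y p <= 1.

Lemma gapC p q : gap p q = gap q p.
Proof. by apply/funext => y; rewrite /gap distrC. Qed.

Lemma gap_ge0 p q y : 0 <= gap p q y.
Proof. exact: normr_ge0. Qed.

Lemma gap_id p y : gap p p y = 0.
Proof. by rewrite /gap subrr normr0. Qed.

Lemma gap_triangle r p q y : gap p q y <= gap p r y + gap r q y.
Proof. by rewrite /gap; apply: le_trans (ler_normD _ _); rewrite addrA subrK. Qed.

Lemma spreadE p q r y : p != q -> p != r -> q != r ->
  spread y = gap p q y + gap p r y + gap q r y.
Proof.
rewrite /spread /gap.
have := distrC (y None) (y (Some false)).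
have := distrC (y None) (y (Some true)).
have := distrC (y (Some true)) (y (Some false)).
by case: p q r => [[]|] [[]|] [[]|] //= *; lra.
Qed.

Lemma spread_comp (T : state -> state) y : injective T -> spread (y \o T) = spread y.
Proof.
move=> Tinj.
by rewrite [RHS](@spreadE (T None) (T (Some false)) (T (Some true))) // inj_eq.
Qed.

Lemma third p q : p != q -> exists r : state, p != r /\ q != r.
Proof.
by case: p q => [[]|] [[]|] // _;
  [exists None | exists (Some false) | exists None | exists (Some true)
  | exists (Some false) | exists (Some true)].
Qed.

Lemma three_states (p q r x : state) : p != q -> p != r -> q != r ->
  [|| x == p, x == q | x == r].
Proof. by case: p q r x => [[]|] [[]|] [[]|] [[]|]. Qed.

Lemma gap_le_spread p q y : 2 * gap p q y <= spread y.
Proof.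
have [->|pq] := eqVneq p q.
  by rewrite gap_id mulr0 !addr_ge0 ?gap_ge0.
have [r [pr qr]] := third pq; rewrite (spreadE y pq pr qr).
by have := gap_triangle r p q y; rewrite (gapC q r); lra.
Qed.

Lemma spread_unit y : unit_vec y -> spread y <= 2.
Proof.
move=> y01; rewrite /spread /gap.
have := y01 None; have := y01 (Some true); have := y01 (Some false).
move: (y None) (y (Some true)) (y (Some false)) => a b c.
move=> /andP[? ?] /andP[? ?] /andP[? ?].
by case: (ger0P (a - c)); case: (ger0P (a - b)); case: (ger0P (c - b)) => *; lra.
Qed.

Lemma avg_unit l y : unit_vec y -> unit_vec (avg l y).
Proof.
move=> y01 p; rewrite /avg; move: (y01 (l false p)) (y01 (l true p)).
by move=> /andP[? ?] /andP[? ?]; apply/andP; split; lra.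
Qed.

Lemma avgs_unit D y : unit_vec y -> unit_vec (avgs D y).
Proof. by move=> y01; elim: D => [|l D IH] //=; apply: avg_unit. Qed.

Lemma gap_unit p q y : unit_vec y -> gap p q y <= 1.
Proof.
by move=> /spread_unit; have := gap_le_spread p q y; lra.
Qed.

Lemma half_norm_add (a b : R) : `|(a + b) / 2| <= (`|a| + `|b|) / 2.
Proof. by rewrite normrM (@ger0_norm _ 2^-1) ?invr_ge0 // ler_pM2r ?invr_gt0 // ler_normD. Qed.

Lemma half_norm_sub (a b : R) : `|(a - b) / 2| <= (`|a| + `|b|) / 2.
Proof. by rewrite -(normrN b) half_norm_add. Qed.

Lemma gap_avgE l p q y : gap p q (avg l y) =
  `|((y (l false p) - y (l false q)) + (y (l true p) - y (l true q))) / 2|.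
Proof. by rewrite /gap /avg; congr `|_|; field. Qed.

Lemma gap_hdiffE l p q y : gap p q (hdiff l y) =
  `|((y (l false p) - y (l false q)) - (y (l true p) - y (l true q))) / 2|.
Proof. by rewrite /gap /hdiff; congr `|_|; field. Qed.

Lemma gap_avg l p q y : gap p q (avg l y) <=
  (gap (l false p) (l false q) y + gap (l true p) (l true q) y) / 2.
Proof. by rewrite gap_avgE half_norm_add. Qed.

Lemma gap_hdiff l p q y : gap p q (hdiff l y) <=
  (gap (l false p) (l false q) y + gap (l true p) (l true q) y) / 2.
Proof. by rewrite gap_hdiffE half_norm_sub. Qed.

(** For d0, d1 in [-1, 1], |d0 + d1| / 2 + |d0 - d1| / 2 = max(|d0|, |d1|) <= 1; here d0 and d1 are
    the differences seen along the two bits. *)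
Lemma gap_hdiff_unit l p q y : unit_vec y ->
  gap p q (hdiff l y) <= 2 * (1 - gap p q (avg l y)).
Proof.
move=> y01; rewrite gap_hdiffE gap_avgE.
move: (y01 (l false p)) (y01 (l false q)) (y01 (l true p)) (y01 (l true q)).
move: (y (l false p)) (y (l false q)) (y (l true p)) (y (l true q)) => a b c d.
move=> /andP[? ?] /andP[? ?] /andP[? ?] /andP[? ?].
by case: (ger0P ((a - b + (c - d)) / 2));
  case: (ger0P ((a - b - (c - d)) / 2)) => *; lra.
Qed.

End Functionals.

Arguments wstep {R} t l N.
Arguments spread {R}.
Arguments gap {R} p q.
Arguments gapC {R} p q.

(** * Contraction under permutation layers *)

Section PermutationLayers.

Variable R : realFieldType.

Notation vec := (state -> R).
Notation functional := (vec -> R).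
Notation wsum t := (run_op (@wstep R t)).

Implicit Types (l : layer) (D L P : seq layer) (t : R) (y : vec) (N : functional).

(* (a, b, c) and (a', b', c') are the values of y at the images of three states
   under the two permutations of a layer. *)
Lemma permutation_inequalities t (a b c a' b' c' : R) : 0 <= t -> t <= 1 / 4 ->
  (a', b', c') \in [:: (a, b, c); (b, a, c); (c, b, a); (a, c, b); (b, c, a); (c, a, b)] ->
  let z1 := `|((a - b) + (a' - b')) / 2| in
  let z2 := `|((a - c) + (a' - c')) / 2| in
  let z3 := `|((b - c) + (b' - c')) / 2| in
  let w1 := `|((a - b) - (a' - b')) / 2| in
  let w2 := `|((a - c) - (a' - c')) / 2| in
  let w3 := `|((b - c) - (b' - c')) / 2| in
  let s := `|a - b| + `|a - c| + `|b - c| in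
  (z1 + z2 + z3) + (w1 + w2 + w3) / 2 <= s /\
  z1 + 2 * t * (z1 + z2 + z3) + t * (w1 + 2 * t * (w1 + w2 + w3))
    <= (`|a - b| + `|a' - b'|) / 2 + 2 * t * s.
Proof.
move=> t0 t4 mem z1 z2 z3 w1 w2 w3 s.
have Hz1 : z1 <= (`|a - b| + `|a' - b'|) / 2 := half_norm_add _ _.
have Hz2 : z2 <= (`|a - c| + `|a' - c'|) / 2 := half_norm_add _ _.
have Hz3 : z3 <= (`|b - c| + `|b' - c'|) / 2 := half_norm_add _ _.
have Hw1 : w1 <= (`|a - b| + `|a' - b'|) / 2 := half_norm_sub _ _.
have Hw2 : w2 <= (`|a - c| + `|a' - c'|) / 2 := half_norm_sub _ _.
have Hw3 : w3 <= (`|b - c| + `|b' - c'|) / 2 := half_norm_sub _ _.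
have T1 : `|a - b| <= `|a - c| + `|b - c|.
  by rewrite (distrC b) (le_trans _ (ler_normD _ _)) // addrA subrK.
have T2 : `|a - c| <= `|a - b| + `|b - c|.
  by rewrite (le_trans _ (ler_normD _ _)) // addrA subrK.
have T3 : `|b - c| <= `|a - b| + `|a - c|.
  by rewrite (distrC a b) (le_trans _ (ler_normD _ _)) // addrA subrK.
have halfE x e : x = e / 2 -> `|x| = `|e| / 2.
  by move=> ->; rewrite normrM (@ger0_norm _ 2^-1) ?invr_ge0.
(* [Hz1] takes care of the leading z1, and t <= 1/4 bounds 2 t^2 (w1 + w2 + w3) by t/2 times that
   sum; dividing by t leaves an inequality free of t. *)
suff [Hs Hp] : (z1 + z2 + z3) + (w1 + w2 + w3) / 2 <= s /\
    2 * (z1 + z2 + z3) + (w1 + (w1 + w2 + w3) / 2) <= 2 * s.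
  split=> //.
  have W0 : 0 <= t * (w1 + w2 + w3) by rewrite mulr_ge0 // !addr_ge0 /w1 /w2 /w3.
  by have := ler_wpM2l t0 Hp; have := ler_wpM2r W0 t4; lra.
have D1 := distrC b a; have D2 := distrC c a; have D3 := distrC c b.
(* Relative to each other the two permutations differ by the identity (all w vanish), a
   transposition (one z vanishes, two w are half the swapped distance) or a 3-cycle (each z is half
   a distance). *)
move: mem; rewrite !inE => /or4P[| | |/or3P[| |]] /eqP[? ? ?]; subst a' b' c'.
- have E1 : w1 = 0 by rewrite /w1 subrr mul0r normr0.
  have E2 : w2 = 0 by rewrite /w2 subrr mul0r normr0.
  have E3 : w3 = 0 by rewrite /w3 subrr mul0r normr0.
  by rewrite /s; split; lra.
- have E1 : z1 = 0 by rewrite /z1 addrA subrK subrr mul0r normr0.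
  have E2 : w2 = `|a - b| / 2 by apply: halfE; field.
  have E3 : w3 = `|b - a| / 2 by apply: halfE; field.
  by rewrite /s; split; lra.
- have E1 : z2 = 0 by rewrite /z2 addrA subrK subrr mul0r normr0.
  have E2 : w1 = `|a - c| / 2 by apply: halfE; field.
  have E3 : w3 = `|a - c| / 2 by apply: halfE; field.
  by rewrite /s; split; lra.
- have E1 : z3 = 0 by rewrite /z3 addrA subrK subrr mul0r normr0.
  have E2 : w1 = `|c - b| / 2 by apply: halfE; field.
  have E3 : w2 = `|b - c| / 2 by apply: halfE; field.
  by rewrite /s; split; lra.
- have E1 : z1 = `|a - c| / 2 by apply: halfE; field.
  have E2 : z2 = `|b - c| / 2 by apply: halfE; field.
  have E3 : z3 = `|b - a| / 2 by apply: halfE; field.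
  by rewrite /s; split; lra.
- have E1 : z1 = `|c - b| / 2 by apply: halfE; field.
  have E2 : z2 = `|a - b| / 2 by apply: halfE; field.
  have E3 : z3 = `|a - c| / 2 by apply: halfE; field.
  by rewrite /s; split; lra.
Qed.

Lemma perm_layer_inj l b : perm_layer l -> injective (l b).
Proof. by case/andP=> /injectiveP ? /injectiveP ?; case: b. Qed.

Lemma perm_layer_values l y p q r : perm_layer l -> p != q -> p != r -> q != r ->
  (y (l true p), y (l true q), y (l true r)) \in
    [:: (y (l false p), y (l false q), y (l false r)); (y (l false q), y (l false p), y (l false r));
        (y (l false r), y (l false q), y (l false p)); (y (l false p), y (l false r), y (l false q));
        (y (l false q), y (l false r), y (l false p)); (y (l false r), y (l false p), y (l false q))].
Proof.
move=> lP pq pr qr; set u := l false; set v := l true.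
have [uI vI] : injective u /\ injective v by split; apply: perm_layer_inj.
have uD x x' : x != x' -> u x != u x' by rewrite (inj_eq uI).
have vD x x' : x != x' -> v x == v x' -> False by rewrite -(inj_eq vI) => /negPf->.
have Hv x : [|| v x == u p, v x == u q | v x == u r].
  by apply: three_states; apply: uD.
move: (vD _ _ pq) (vD _ _ pr) (vD _ _ qr).
by case/or3P: (Hv p) => /eqP->; case/or3P: (Hv q) => /eqP->;
  case/or3P: (Hv r) => /eqP->; rewrite ?eqxx => V1 V2 V3;
  try (by case: V1); try (by case: V2); try (by case: V3);
  rewrite !inE !eqxx ?orbT.
Qed.

Lemma spread_step l y : perm_layer l ->
  spread (avg l y) + spread (hdiff l y) / 2 <= spread y.
Proof.
move=> lP; rewrite -(spread_comp y (perm_layer_inj (b := false) lP)) {1 2}/spread.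
rewrite !gap_avgE !gap_hdiffE.
have v := @perm_layer_values l y None (Some false) (Some true) lP isT isT isT.
(* The first inequality does not involve t, so it is taken at t = 0. *)
by case: (permutation_inequalities (lexx 0) _ v) => [|]; [lra | rewrite /=].
Qed.

(** A distance alone can exceed its mean over the pairs reached once the half-difference is added;
    the loss of spread in the padding pays for it. *)
Definition padded_gap t p q : functional := fun y => gap p q y + 2 * t * spread y.

Lemma wstep_padded_gap t l p q y : 0 <= t -> t <= 1 / 4 -> perm_layer l -> p != q ->
  wstep t l (padded_gap t p q) y <=
  (padded_gap t (l false p) (l false q) y + padded_gap t (l true p) (l true q) y) / 2.
Proof.
move=> t0 t4 lP pq; have [r [pr qr]] := third pq.
have [_] := permutation_inequalities t0 t4 (perm_layer_values y lP pq pr qr).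
rewrite /wstep /padded_gap.
rewrite (spreadE (avg l y) pq pr qr) (spreadE (hdiff l y) pq pr qr).
rewrite -(spread_comp y (perm_layer_inj (b := false) lP)) (spreadE _ pq pr qr).
rewrite !gap_avgE !gap_hdiffE /gap /=; lra.
Qed.

Lemma wstep_spread_le t l y : 0 <= t -> t <= 1 / 4 -> perm_layer l ->
  wstep t l spread y <= spread y.
Proof.
move=> t0 t4 lP; have := spread_step y lP.
have s0 : 0 <= spread (hdiff l y) by rewrite !addr_ge0 ?gap_ge0.
by rewrite /wstep; have := ler_wpM2r s0 t4; lra.
Qed.

(** Telescoping: by [spread_step] each half-difference has at most twice the spread lost by
    averaging at that layer, and earlier layers do not amplify it. *)
Lemma wsum_pos_spread t P y : 0 <= t -> t <= 1 / 4 -> all perm_layer P ->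
  wsum_pos t P spread y <= 2 * t * (spread y - spread (avgs P y)).
Proof.
move=> t0 t4; elim: P => [|l P IH] /=; first by rewrite subrr mulr0.
case/andP=> lP /IH {}IH; have le := wsum_pos_le P y t0 (fun y => wstep_spread_le y t0 t4 lP).
by have := ler_wpM2l t0 (spread_step (avgs P y) lP); lra.
Qed.

(** A distance is at most half the spread, and the spread of y is at most 2. *)
Lemma wsum_pos_perm_gap t P p q y : 0 <= t -> t <= 1 / 4 -> all perm_layer P ->
  unit_vec y -> wsum_pos t P (gap p q) y <= 2 * t * (1 - gap p q (avgs P y)).
Proof.
move=> t0 t4 PP y01.
have le : wsum_pos t P (gap p q) y <= wsum_pos t P (fun y => 2^-1 * spread y) y.
  by apply: wsum_pos_le => // z; have := gap_le_spread p q z; lra.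
rewrite wsum_pos_scale in le.
have := wsum_pos_spread y t0 t4 PP.
have := ler_wpM2l t0 (spread_unit y01).
by have := ler_wpM2l t0 (gap_le_spread p q (avgs P y)); lra.
Qed.

(* The mean of F over the pairs reached from (p, q) on a uniformly random input. *)
Fixpoint pair_avg P p q (F : state -> state -> R) :=
  if P is l :: P' then
    (pair_avg P' (l false p) (l false q) F + pair_avg P' (l true p) (l true q) F) / 2
  else F p q.

Lemma pair_avg_le P p q F F' : (forall a b, F a b <= F' a b) ->
  pair_avg P p q F <= pair_avg P p q F'.
Proof.
move=> leF; elim: P p q => [|l P IH] p q //=.
by rewrite ler_pM2r ?invr_gt0 // lerD.
Qed.

Lemma pair_avg_lin P p q c c' F F' :
  pair_avg P p q (fun a b => c * F a b + c' * F' a b) =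
  c * pair_avg P p q F + c' * pair_avg P p q F'.
Proof. by elim: P p q => [|l P IH] p q //=; rewrite !IH; field. Qed.

Lemma pair_avg_sym P p q F : (forall a b, F a b = F b a) ->
  pair_avg P p q F = pair_avg P q p F.
Proof. by move=> FC; elim: P p q => [|l P IH] p q //=; rewrite (IH (l false p)) (IH (l true p)). Qed.

Lemma pair_avg_const P p q c : pair_avg P p q (fun _ _ => c) = c.
Proof. by elim: P p q => [|l P IH] p q //=; rewrite !IH; field. Qed.

Lemma wsum_pos_pair_avg t D P p q (F : state -> state -> functional) y :
  wsum_pos t D (fun y => pair_avg P p q (fun a b => F a b y)) y =
  pair_avg P p q (fun a b => wsum_pos t D (F a b) y).
Proof.
elim: P p q => [|l P IH] p q //=; rewrite -!IH.
have -> : (fun y => (pair_avg P (l false p) (l false q) (fun a b => F a b y) +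
       pair_avg P (l true p) (l true q) (fun a b => F a b y)) / 2) =
  (fun y => 2^-1 * pair_avg P (l false p) (l false q) (fun a b => F a b y) +
       2^-1 * pair_avg P (l true p) (l true q) (fun a b => F a b y)).
  by apply/funext => z; field.
by rewrite wsum_pos_lin; field.
Qed.

Lemma pair_avg_slack P p q y :
  pair_avg P p q (fun a b => 1 - gap a b y) <= 1 - gap p q (avgs P y).
Proof.
elim: P p q => [|l P IH] p q //=.
have := gap_avg l p q (avgs P y).
by have := IH (l false p) (l false q); have := IH (l true p) (l true q); lra.
Qed.

Lemma wsum_padded_gap t P p q y : 0 <= t -> t <= 1 / 4 -> all perm_layer P -> p != q ->
  wsum t P (padded_gap t p q) y <= pair_avg P p q (fun a b => padded_gap t a b y).
Proof.
move=> t0 t4; elim: P p q y => [|l P IH] p q y; first by [].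
move=> /andP[lP PP] pq; rewrite run_op_cons.
pose N1 := padded_gap t (l false p) (l false q).
pose N2 := padded_gap t (l true p) (l true q).
have le : forall y, wstep t l (padded_gap t p q) y <= 2^-1 * N1 y + 2^-1 * N2 y.
  by move=> z; have := wstep_padded_gap z t0 t4 lP pq; rewrite -/N1 -/N2; lra.
apply: le_trans (run_op_le P (wstep_monotone t0) le y) _.
rewrite run_op_lin; last exact: wstep_linear.
have /(IH _ _ y PP) : l false p != l false q by rewrite (inj_eq (perm_layer_inj lP)).
have /(IH _ _ y PP) : l true p != l true q by rewrite (inj_eq (perm_layer_inj lP)).
by rewrite /= -/N1 -/N2; lra.
Qed.

(** Two different edges of the triangle of states, orientation ignored. *)
Definition distinct_pairs (p q p' q' : state) :=
  [&& p != q, p' != q', (p != p') || (q != q') & (p != q') || (q != p')].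

(** Two edges of a triangle are together at least as long as the third, hence at least half the
    perimeter; permutations keep different edges different. *)
Lemma pair_avg_distinct P p q p' q' y : all perm_layer P -> distinct_pairs p q p' q' ->
  spread y / 2 <= pair_avg P p q (fun a b => gap a b y) +
                  pair_avg P p' q' (fun a b => gap a b y).
Proof.
elim: P p q p' q' => [|l P IH] p q p' q' /=.
  move=> _; rewrite /spread /gap.
  have T a b c := @gap_triangle R a b c y; rewrite /gap in T.
  have := T None (Some true) (Some false); have := T (Some true) None (Some false).
  have := T (Some false) None (Some true).
  have := distrC (y None) (y (Some false)).
  have := distrC (y None) (y (Some true)).
  have := distrC (y (Some true)) (y (Some false)).
  by case: p q p' q' => [[]|] [[]|] [[]|] [[]|] //= *; lra.
case/andP=> lP PP d.
have d' b : distinct_pairs (l b p) (l b q) (l b p') (l b q').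
  by rewrite /distinct_pairs !(inj_eq (perm_layer_inj lP)).
by have := IH _ _ _ _ PP (d' false); have := IH _ _ _ _ PP (d' true); lra.
Qed.

(* If some layer may send {p, q} to two distinct pairs, the mean distance is at
   least a quarter of the spread and absorbs the padding; the layers before it send
   {p, q} to a single pair, and cost nothing. *)
Lemma wsum_perm_gap t P p q y : 0 <= t -> t <= 1 / 4 -> all perm_layer P -> p != q ->
  wsum t P (gap p q) y <= (1 + 8 * t) * pair_avg P p q (fun a b => gap a b y).
Proof.
move=> t0 t4; elim: P p q => [|l P IH] p q PP pq.
  by rewrite /run_op /= ler_peMl ?gap_ge0 //; lra.
have /andP[lP PP'] : all perm_layer (l :: P) := PP.
have Dp b : l b p != l b q by rewrite (inj_eq (perm_layer_inj lP)).
have A0 := pair_avg_sym P (l true p) (l true q) (fun a b => congr1 (fun f => f y) (@gapC R a b)).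
rewrite run_op_cons /=.
have [dist|] := boolP (distinct_pairs (l false p) (l false q) (l true p) (l true q)).
  have ge := pair_avg_distinct y PP' dist.
  have le := wsum_padded_gap y t0 t4 PP pq.
  have {}le : wsum t (l :: P) (gap p q) y <= pair_avg (l :: P) p q (fun a b => padded_gap t a b y).
    apply: le_trans le; apply: run_op_le; first exact: wstep_monotone.
    by move=> z; rewrite /padded_gap lerDl !mulr_ge0 // !addr_ge0 ?gap_ge0.
  rewrite run_op_cons in le; apply: le_trans le _.
  have -> : pair_avg (l :: P) p q (fun a b => padded_gap t a b y) =
    pair_avg (l :: P) p q (fun a b => 1 * gap a b y + 2 * t * spread y).
    by congr pair_avg; apply/funext => a; apply/funext => b; rewrite /padded_gap mul1r.
  (* By [ge] the spread is at most 4 times the mean distance, so the padding 2t [spread y] costs at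
     most 8t times that mean. *)
  rewrite pair_avg_lin pair_avg_const /=.
  by have := ler_wpM2l t0 ge; lra.
rewrite /distinct_pairs !Dp /= negb_and !negb_or !negbK => same.
have [A le] : pair_avg P (l true p) (l true q) (fun a b => gap a b y) =
         pair_avg P (l false p) (l false q) (fun a b => gap a b y) /\
         forall z, wstep t l (gap p q) z <= gap (l false p) (l false q) z.
  (* With equal orientations the half-difference vanishes; with opposite ones the average does, and
     the half-difference is weighted by t <= 1. *)
  case/orP: same => /andP[/eqP e1 /eqP e2].
    rewrite -e1 -e2; split=> // z; rewrite /wstep gap_avgE gap_hdiffE -e1 -e2 /gap.
    rewrite subrr mul0r normr0 mulr0 addr0.
    by rewrite -mulr2n -[_ *+ 2]mulr_natr mulfK ?pnatr_eq0.
  rewrite A0 -e1 -e2; split=> // z; rewrite /wstep gap_avgE gap_hdiffE -e1 -e2 /gap.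
  rewrite addrA subrK subrr mul0r normr0 add0r -[X in _ - X]opprB opprK.
  rewrite -mulr2n -[_ *+ 2]mulr_natr mulfK ?pnatr_eq0 //.
  by rewrite ler_piMl //; lra.
have := run_op_le P (wstep_monotone t0) le y.
by have := IH _ _ PP' (Dp false); rewrite A; lra.
Qed.

End PermutationLayers.

(** * Blocks with non-permutation layers, and their concatenation under restriction *)

Section Concatenation.

Variable R : realFieldType.

Notation vec := (state -> R).
Notation functional := (vec -> R).
Notation wsum t := (run_op (@wstep R t)).

Implicit Types (l : layer) (D L P : seq layer) (t : R) (y : vec) (N : functional).

(** Sets meeting [D] cost at most 1 + t times the mean of the bounds for the two pairs reached
    through [l], controlled by convexity; the set of [l] alone costs 2t by [gap_hdiff_unit]. *)
Lemma wsum_pos_gap_cons t l D y k p q : 0 <= t -> 0 <= k -> unit_vec y ->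
  (forall a b, wsum_pos t D (gap a b) y <= k * (1 - gap a b (avgs D y))) ->
  wsum_pos t (l :: D) (gap p q) y <=
    ((1 + t) * k + 2 * t) * (1 - gap p q (avgs (l :: D) y)).
Proof.
move=> t0 k0 y01 IH /=.
pose g0 := @gap R (l false p) (l false q); pose g1 := @gap R (l true p) (l true q).
have le z : wstep t l (gap p q) z <= (1 + t) / 2 * g0 z + (1 + t) / 2 * g1 z.
  have := gap_avg l p q z; have := ler_wpM2l t0 (gap_hdiff l p q z).
  by rewrite /wstep -/g0 -/g1; lra.
have := wsum_pos_le D y t0 le; rewrite wsum_pos_lin.
have yD := avgs_unit D y01.
have := ler_wpM2l t0 (gap_hdiff_unit l p q yD).
have t1 : 0 <= (1 + t) / 2 by lra.
have := ler_wpM2l t1 (IH (l false p) (l false q)).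
have := ler_wpM2l t1 (IH (l true p) (l true q)).
have tk : 0 <= (1 + t) * k by rewrite mulr_ge0 //; lra.
have := ler_wpM2l tk (gap_avg l p q (avgs D y)).
by rewrite -/g0 -/g1; lra.
Qed.

Definition collisions D := count (fun l => ~~ perm_layer l) D.

Lemma collisions_rcons D l :
  collisions (rcons D l) = (collisions D + ~~ perm_layer l)%N.
Proof. by rewrite /collisions -cats1 count_cat /= addn0. Qed.

Lemma wsum_pos_gap_diag t D p y : wsum_pos t D (gap p p) y = 0.
Proof.
have -> : gap p p = (fun y => 0 * gap p p y).
  by apply/funext => z; rewrite gap_id mul0r.
by rewrite wsum_pos_scale mul0r.
Qed.

(** [P] collects the permutation layers met since the last collision. At the next one, [P]
    multiplies the weight of sets meeting the remainder by 1 + 8t and adds 2t for sets within [P],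
    whatever its length. *)
Lemma wsum_pos_gap t P D p q y : 0 <= t -> t <= 1 / 4 -> unit_vec y ->
  all perm_layer P ->
  wsum_pos t (P ++ D) (gap p q) y <=
    ((1 + 11 * t) ^+ (collisions D).+1 - 1) * (1 - gap p q (avgs (P ++ D) y)).
Proof.
move=> t0 t4 y01; have u1 : 1 <= 1 + 11 * t by lra.
elim: D P p q => [|l D IH] P p q PP.
  have U0 : 0 <= 1 - gap p q (avgs P y) by rewrite subr_ge0 gap_unit //; apply: avgs_unit.
  rewrite cats0 expr1; have := wsum_pos_perm_gap p q t0 t4 PP y01.
  by have := mulr_ge0 t0 U0; lra.
have [lP|lnP] := boolP (perm_layer l).
  have := IH (rcons P l) p q; rewrite all_rcons lP /= => /(_ PP).
  by rewrite cat_rcons /collisions /= lP.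
have [->|pq] := eqVneq p q.
  rewrite wsum_pos_gap_diag gap_id subr0 mulr1 subr_ge0 exprn_ege1 //.
have yX : unit_vec (avgs (l :: D) y) by apply: avgs_unit.
rewrite wsum_pos_cat; set X := l :: D in yX *.
rewrite /collisions /X /= lnP -/(collisions D) add1n exprS -/X.
set v := (1 + 11 * t) ^+ (collisions D).+1.
pose k := v - 1; have k0 : 0 <= k by rewrite subr_ge0 exprn_ege1.
pose K := (1 + t) * k + 2 * t.
have K0 : 0 <= K by rewrite addr_ge0 // ?mulr_ge0 //; lra.
have step a b : wsum_pos t X (gap a b) y <= K * (1 - gap a b (avgs X y)).
  apply: wsum_pos_gap_cons => // a' b'; exact: (IH [::]).
have le1 : wsum_pos t X (wsum t P (gap p q)) y <=
    (1 + 8 * t) * (K * (1 - gap p q (avgs (P ++ X) y))).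
  have le z : wsum t P (gap p q) z <=
      (1 + 8 * t) * pair_avg P p q (fun a b => gap a b z) by apply: wsum_perm_gap.
  apply: le_trans (wsum_pos_le X y t0 le) _.
  rewrite wsum_pos_scale (wsum_pos_pair_avg t X P p q gap y).
  rewrite ler_wpM2l //; first by lra.
  apply: le_trans (pair_avg_le P p q step) _.
  rewrite (_ : (fun a b => _) = (fun a b => K * (1 - gap a b (avgs X y)) + 0 * 0)).
    rewrite (pair_avg_lin _ _ _ _ _ (fun a b => 1 - gap a b (avgs X y)) (fun _ _ => 0)).
    rewrite mul0r addr0 ler_wpM2l // /avgs foldr_cat.
    exact: (pair_avg_slack P p q (avgs X y)).
  by apply/funext => a; apply/funext => b; rewrite mul0r addr0.
have le2 := wsum_pos_perm_gap p q t0 t4 PP yX.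
rewrite (_ : avgs P (avgs X y) = avgs (P ++ X) y) in le2; last by rewrite /avgs foldr_cat.
have U0 : 0 <= 1 - gap p q (avgs (P ++ X) y).
  by rewrite subr_ge0 gap_unit //; apply: avgs_unit.
apply: le_trans (lerD le1 le2) _; rewrite mulrA -mulrDl ler_wpM2r //.
(* As t <= 1/4, (1 + 8t) K + 2t is at most k + 11tk + 8t, hence at most (1 + 11t)(k + 1) - 1; this
   is where 11 comes from. *)
have tk : 0 <= t * k by rewrite mulr_ge0.
have := ler_wpM2l tk t4; have := ler_wpM2l t0 t4.
have vE : v = k + 1 by rewrite subrK.
have tvE : t * v = t * k + t by rewrite vE; ring.
by rewrite /K; lra.
Qed.

(** With d the distance after averaging, the total is at most d + B (1 - d). *)
Lemma wsum_gap_le t D p q y B : 0 <= t -> t <= 1 / 4 -> unit_vec y -> 1 <= B ->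
  (1 + 11 * t) ^+ (collisions D).+1 - 1 <= B -> wsum t D (gap p q) y <= B.
Proof.
move=> t0 t4 y01 B1 kB; have := @wsum_pos_gap t [::] D p q y t0 t4 y01 isT.
have := avgs_unit D y01 => yD; have := gap_unit p q yD; have := gap_ge0 p q (avgs D y).
rewrite wsumE cat0s; set d := gap _ _ _ => d0 d1.
have U0 : 0 <= 1 - d by lra.
by have := ler_wpM2r U0 kB; have := ler_wpM2r d0 B1; lra.
Qed.

(** [avg] fixes constants, [hdiff] kills them, and both are linear. *)
Lemma wsum_gap_affine t D p q y (a c : R) :
  wsum t D (gap p q) (fun s => a + c * y s) = `|c| * wsum t D (gap p q) y.
Proof.
pose hom N := forall a c y, N (fun s => a + c * y s) = `|c| * N y.
suff H N : hom N -> hom (wsum t D N).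
  by apply: H => {}a {}c {}y; rewrite /gap -normrM; congr `|_|; ring.
elim: D N => [|l D IH] N homN //; apply: IH => {}a {}c {}y.
rewrite /wstep.
have -> : avg l (fun s => a + c * y s) = (fun s => a + c * avg l y s).
  by apply/funext => s; rewrite /avg; field.
have -> : hdiff l (fun s => a + c * y s) = (fun s => 0 + c * hdiff l y s).
  by apply/funext => s; rewrite /hdiff; field.
by rewrite !homN; ring.
Qed.

(** Lets an injective restriction count as one more permutation layer of the block. *)
Lemma wsum_gap_const_layer t D p q T y :
  wsum t D (gap p q) (y \o T) = wstep t (const_layer T) (wsum t D (gap p q)) y.
Proof.
rewrite /wstep.
have -> : avg (const_layer T) y = y \o T.
  by apply/funext => s; rewrite /avg /=; field.
have -> : hdiff (const_layer T) y = fun s => 0 + 0 * y s.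
  by apply/funext => s; rewrite /hdiff /= subrr !mul0r addr0.
by rewrite wsum_gap_affine normr0 mul0r mulr0 addr0.
Qed.

(** If [T] merges x and x', then up to a constant [y \o T] is a multiple of the indicator of the
    third state r. Thus y enters only through the distance of [T r] and [T x], and the indicator has
    weight at most [B]. *)
Lemma wsum_gap_bottleneck t D p q (T : state -> state) B :
  0 <= t -> t <= 1 / 4 -> 1 <= B -> (1 + 11 * t) ^+ (collisions D).+1 - 1 <= B ->
  ~~ injectiveb T ->
  exists a b, forall y, wsum t D (gap p q) (y \o T) <= B * gap a b y.
Proof.
move=> t0 t4 B1 kB /injectivePn[x [x' xx' eT]]; have [r [xr x'r]] := third xx'.
exists (T r), (T x) => y.
have -> : y \o T = fun s => y (T x) + (y (T r) - y (T x)) * (s == r)%:R.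
  apply/funext => s /=; have /or3P[] := three_states s xx' xr x'r => /eqP->.
  - by rewrite (negPf xr) mulr0 addr0.
  - by rewrite (negPf x'r) mulr0 addr0 eT.
  - by rewrite eqxx mulr1 addrC subrK.
rewrite wsum_gap_affine mulrC ler_wpM2r //.
by apply: wsum_gap_le => // s; case: (s == r); rewrite ?lexx ?ler01.
Qed.

(* [wstep] averaged over a restriction fixing the bit with probability 1/2 when the
   layer is not a permutation layer. *)
Definition rstep t l N : functional :=
  if perm_layer l then wstep t l N
  else fun y => wstep t l N y / 2 + (N (y \o l false) + N (y \o l true)) / 4.

Lemma rstep_monotone t : 0 <= t -> monotone_op (rstep t).
Proof.
move=> t0 l N N' leN y; rewrite /rstep; case: ifP => _; first exact: wstep_monotone.
have := @wstep_monotone _ t t0 l _ _ leN y.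
by have := leN (y \o l false); have := leN (y \o l true); lra.
Qed.

Lemma rstep_linear t : linear_op (rstep t).
Proof.
move=> l c c' N N'; rewrite /rstep wstep_linear; case: ifP => _ //.
by apply/funext => y; field.
Qed.

(** A potential argument: an open block with m collisions carries 1 + 4r (6/5)^m, and each layer
    costs a factor 1 + 2r. A non-injective restriction closes the block at price 1 + r (6/5)^m and
    resets m to 0. *)
Lemma rsum_gap_le t (r : R) L D p q y : 0 <= t -> t <= 1 / 4 -> 0 <= r -> r <= 1 / 16 ->
  (forall m, (1 + 11 * t) ^+ m.+1 - 1 <= 1 + r * (6 / 5) ^+ m) -> unit_vec y ->
  run_op (rstep t) L (wsum t D (gap p q)) y <=
    (1 + 4 * r * (6 / 5) ^+ collisions D) * (1 + 2 * r) ^+ size L.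
Proof.
move=> t0 t4 r0 r16 hr y01; have c0 m : 0 <= (6 / 5) ^+ m :> R by rewrite exprn_ge0 //; lra.
have rc0 m : 0 <= r * (6 / 5) ^+ m by rewrite mulr_ge0.
elim: L D p q => [|l L IH] D p q.
  rewrite mulr1; apply: wsum_gap_le => //; first by have := rc0 (collisions D); lra.
  by have := hr (collisions D); have := rc0 (collisions D); lra.
rewrite run_op_cons exprS; set V := (1 + 2 * r) ^+ size L.
have V0 : 0 <= V by rewrite exprn_ge0 //; lra.
have consE : wstep t l (wsum t D (gap p q)) = wsum t (rcons D l) (gap p q).
  by rewrite run_op_rcons.
have := IH (rcons D l) p q; rewrite -consE collisions_rcons.
have := rc0 (collisions D).
set m := collisions D; set X := (6 / 5) ^+ m => rX.
have [lP|lP] := boolP (perm_layer l).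
  rewrite addn0 -/X [rstep t l _]/rstep lP => H; apply: le_trans H _.
  rewrite mulrA ler_wpM2r //.
  by have := mulr_ge0 r0 rX; lra.
rewrite addn1 exprS -/X -/V [rstep t l _]/rstep (negPf lP) => H1.
pose B := 1 + r * X; have B1 : 1 <= B by rewrite /B; lra.
have Hnon T : ~~ injectiveb T ->
    run_op (rstep t) L (fun y => wsum t D (gap p q) (y \o T)) y <= B * ((1 + 4 * r) * V).
  move=> /(wsum_gap_bottleneck p q t0 t4 B1 (hr _))[a [b le]].
  apply: le_trans (run_op_le L (rstep_monotone t0) le y) _.
  rewrite run_op_scale; last exact: rstep_linear.
  rewrite ler_wpM2l //; first by lra.
  by have := IH [::] a b; rewrite expr0 mulr1.
have Hany T : run_op (rstep t) L (fun y => wsum t D (gap p q) (y \o T)) y <=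
    (1 + 4 * r * X) * ((1 + 4 * r) * V).
  have [/[dup] Tb /injectiveP TI|/Hnon H] := boolP (injectiveb T).
    have cE : wsum t (rcons D (const_layer T)) (gap p q) =
        fun y => wsum t D (gap p q) (y \o T).
      by apply/funext => z; rewrite run_op_rcons wsum_gap_const_layer.
    have := IH (rcons D (const_layer T)) p q.
    rewrite cE collisions_rcons /perm_layer Tb addn0 -/m -/X => H.
    apply: le_trans H _; rewrite ler_wpM2l //; first by lra.
    by rewrite ler_peMl //; lra.
  apply: le_trans H _; rewrite ler_wpM2r //; last by rewrite /B; lra.
  by rewrite mulr_ge0 //; lra.
set N := wsum t D (gap p q) in H1 Hnon Hany *.
pose N0 y := N (y \o l false); pose N1 y := N (y \o l true).
have -> : (fun y => wstep t l N y / 2 + (N (y \o l false) + N (y \o l true)) / 4) =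
   (fun y => 1 * (2^-1 * wstep t l N y + 4^-1 * N0 y) + 4^-1 * N1 y).
  by apply/funext => z; rewrite /N0 /N1; field.
rewrite !run_op_lin; try exact: rstep_linear.
have H3 : run_op (rstep t) L N0 y + run_op (rstep t) L N1 y <=
    (B + (1 + 4 * r * X)) * ((1 + 4 * r) * V).
  move: lP; rewrite /perm_layer negb_and => /orP[] /Hnon H; rewrite mulrDl.
    by apply: lerD; [exact: H | exact: Hany].
  by rewrite [leLHS]addrC; apply: lerD; [exact: H | exact: Hany].
(* The layer survives with probability 1/2 and is fixed to each bit with probability 1/4. The terms
   in 1 and r agree on both sides, while r X has coefficient 12/5 + 5/4 against 4: this leaves room
   for the growth factor 6/5. *)
suff : (1 + 4 * r * (6 / 5 * X)) / 2 * V + (B + (1 + 4 * r * X)) * (1 + 4 * r) / 4 * V <=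
    (1 + 2 * r) * (1 + 4 * r * X) * V by lra.
rewrite -mulrDl ler_wpM2r // /B.
by have := ler_wpM2r rX r16; have := mulr_ge0 r0 rX; lra.
Qed.

End Concatenation.

(** * Numerical bounds, restriction by convexity, and values in terms of distances *)

Section Summation.

Variable R : realFieldType.

Notation vec := (state -> R).
Notation functional := (vec -> R).
Notation wsum t := (run_op (@wstep R t)).

Implicit Types (l : layer) (D L P : seq layer) (t : R) (y : vec) (N : functional).

Lemma expr_inv_bound (x : R) J : 0 <= x -> (1 + x) ^+ J * (1 - J%:R * x) <= 1.
Proof.
move=> x0; elim: J => [|J IH]; first by rewrite expr0 mul0r subr0 mulr1.
apply: le_trans IH; rewrite exprSr -mulrA ler_wpM2l ?exprn_ge0 ?addr_ge0 //.
have Jx : 0 <= J%:R * (x * x) by rewrite mulr_ge0 // mulr_ge0.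
by rewrite -natr1; have := mulr_ge0 x0 x0; lra.
Qed.

Lemma le_two_add_half_expr (v : R) J : 0 <= v -> (1 < J)%N -> v <= 2 + (v / 2) ^+ J.
Proof.
move=> v0 J2; have [v2|v2] := lerP v 2.
  by rewrite (le_trans v2) // lerDl exprn_ge0 // divr_ge0.
have h1 : 1 <= v / 2 by lra.
have : (v / 2) ^+ 2 <= (v / 2) ^+ J by apply: ler_weXn2l.
by rewrite expr2; have := sqr_ge0 (v / 2 - 1); rewrite expr2; lra.
Qed.

(** The J-th power of v = (1 + 11t)^(m+1) is at most (6/5)^(m+1), so v exceeds 2 by at most (v/2)^J,
    where 2^J supplies the factor 1/n. *)
Lemma growth_bound (n J : nat) t m : (0 < n)%N -> (32 * n <= 2 ^ J)%N ->
  t = (66 * J%:R)^-1 ->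
  (1 + 11 * t) ^+ m.+1 - 1 <= 1 + (16 * n%:R)^-1 * (6 / 5) ^+ m.
Proof.
move=> n0 nJ tE.
have J5 : (4 < J)%N.
  rewrite -(ltn_exp2l (m := 2)) //; apply: leq_trans nJ.
  by rewrite -[X in (X < _)%N]/16%N (leq_trans _ (leq_pmulr _ n0)).
have J0 : 0 < J%:R :> R by rewrite ltr0n (leq_trans _ J5).
have t0 : 0 <= t by rewrite tE invr_ge0 mulr_ge0 // ltW.
(* 66 = 6 * 11 is chosen so that (1 + 11t)^J <= 1 / (1 - 1/6) = 6/5. *)
have Jt : J%:R * (11 * t) = 1 / 6 by rewrite tE; field; rewrite lt0r_neq0.
have uJ : (1 + 11 * t) ^+ J <= 6 / 5.
  have x0 : 0 <= 11 * t by rewrite mulr_ge0.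
  by have := expr_inv_bound J x0; rewrite Jt; lra.
set v := (1 + 11 * t) ^+ m.+1.
have u0 : 0 <= 1 + 11 * t by lra.
have v0 : 0 <= v by rewrite exprn_ge0.
have := @le_two_add_half_expr v J v0 (leq_trans _ J5) => /(_ isT).
suff : (v / 2) ^+ J <= (16 * n%:R)^-1 * (6 / 5) ^+ m by lra.
have vJ : v ^+ J <= (6 / 5) * (6 / 5) ^+ m.
  by rewrite -exprS /v -exprM mulnC exprM lerXn2r // nnegrE ?exprn_ge0 //; lra.
have nJR : 32 * n%:R <= 2 ^+ J :> R by rewrite -!natrX -natrM ler_nat.
have nR : 0 < n%:R :> R by rewrite ltr0n.
have c0 : 0 <= (6 / 5) ^+ m :> R by rewrite exprn_ge0 //; lra.
rewrite expr_div_n ler_pdivrMr ?exprn_gt0 //.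
have k2 : 2 <= (16 * n%:R)^-1 * 2 ^+ J :> R by rewrite mulrC ler_pdivlMr ?mulr_gt0 //; lra.
by apply: le_trans vJ _; rewrite [leRHS]mulrAC ler_wpM2r //; lra.
Qed.

Definition midconvex N := forall y y', N (fun s => (y s + y' s) / 2) <= (N y + N y') / 2.

(** Survival with probability 1/2 halves the half-difference term, hence t/2; convexity bounds the
    averaged term by its restrictions. *)
Lemma wsum_le_rsum t L N y : 0 <= t -> (forall y, 0 <= N y) -> midconvex N ->
  wsum (t / 2) L N y <= run_op (rstep t) L N y.
Proof.
move=> t0; have t20 : 0 <= t / 2 by rewrite divr_ge0.
elim: L N => [|l L IH] N N0 Nc //; rewrite !run_op_cons.
have W0 z : 0 <= wstep (t / 2) l N z by rewrite /wstep; apply: addr_ge0 => //; apply: mulr_ge0.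
have Wc : midconvex (wstep (t / 2) l N).
  move=> y1 y2; rewrite /wstep.
  have -> : avg l (fun s => (y1 s + y2 s) / 2) = fun s => (avg l y1 s + avg l y2 s) / 2.
    by apply/funext => s; rewrite /avg; field.
  have -> : hdiff l (fun s => (y1 s + y2 s) / 2) = fun s => (hdiff l y1 s + hdiff l y2 s) / 2.
    by apply/funext => s; rewrite /hdiff; field.
  by have := Nc (avg l y1) (avg l y2); have := ler_wpM2l t20 (Nc (hdiff l y1) (hdiff l y2)); lra.
apply: le_trans (IH _ W0 Wc) _; apply: run_op_le; first exact: rstep_monotone.
move=> z; have := mulr_ge0 t0 (N0 (hdiff l z)).
rewrite /rstep /wstep; case: ifP => _; first by lra.
by have := Nc (z \o l false) (z \o l true); rewrite -/(avg l z); lra.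
Qed.

Lemma gap_midconvex p q : midconvex (@gap R p q).
Proof.
move=> y y'; apply: le_trans (half_norm_add _ _).
by rewrite le_eqVlt; apply/orP; left; apply/eqP; congr `|_|; field.
Qed.

(* Cutting at the smallest element of s reduces values to distances. *)
Lemma wsum_value_le t L u y B : 0 <= t -> unit_vec y ->
  (forall L' p q, (size L' <= size L)%N -> wsum t L' (gap p q) y <= 2 * B) ->
  wsum t L (fun y => `|y u|) y <= 1 + (size L)%:R * (t * B).
Proof.
move=> t0 y01; elim: L u => [|l L IH] u H.
  by rewrite mul0r addr0 /run_op /=; have /andP[y0 y1] := y01 u; rewrite ger0_norm.
have {}IH p := IH p (fun L' p q le => H L' p q (leqW le)).
have le z : wstep t l (fun y => `|y u|) z <=
    1 * (2^-1 * `|z (l false u)| + 2^-1 * `|z (l true u)|) +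
    t / 2 * gap (l false u) (l true u) z.
  rewrite /wstep /avg /hdiff /gap.
  have := half_norm_add (z (l false u)) (z (l true u)).
  rewrite [`|(_ - _) / 2|]normrM (@ger0_norm _ 2^-1) ?invr_ge0 //; lra.
rewrite run_op_cons; apply: le_trans (run_op_le L (wstep_monotone t0) le y) _.
rewrite !run_op_lin; try exact: wstep_linear.
have := IH (l false u); have := IH (l true u).
have := ler_wpM2l t0 (H L (l false u) (l true u) (leqnSn _)).
by rewrite /= -[(size L).+1%:R]natr1; lra.
Qed.

(** * Expansion over bit strings, and Fourier coefficients as matrix products *)

Fixpoint bitsum n (g : seq bool -> R) : R :=
  if n is n'.+1 then bitsum n' (g \o cons false) + bitsum n' (g \o cons true)
  else g [::].

Lemma bitsum_lin n (c c' : R) g g' :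
  bitsum n (fun b => c * g b + c' * g' b) = c * bitsum n g + c' * bitsum n g'.
Proof.
elim: n g g' => [|n IH] g g' //=.
by rewrite (IH (g \o cons false) (g' \o cons false)) (IH (g \o cons true)); ring.
Qed.

(** The Fourier coefficient at the set with indicator string [b], one entry per start state; see
    [coef_bitsum]. *)
Fixpoint coef L (b : seq bool) y : vec :=
  match L, b with
  | l :: L', c :: b' => (if c then hdiff l else avg l) (coef L' b' y)
  | _, _ => y
  end.

Lemma wsum_coef t L N y :
  wsum t L N y = bitsum (size L) (fun b => t ^+ count id b * N (coef L b y)).
Proof.
elim: L N => [|l L IH] N; first by rewrite /run_op /= expr0 mul1r.
rewrite run_op_cons IH /wstep /=.
have -> : (fun b => t ^+ count id b * (N (avg l (coef L b y)) + t * N (hdiff l (coef L b y)))) =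
    (fun b => 1 * (t ^+ count id b * N (avg l (coef L b y))) +
       1 * (t ^+ (count id b).+1 * N (hdiff l (coef L b y)))).
  by apply/funext => b; rewrite exprS; ring.
by rewrite bitsum_lin !mul1r.
Qed.

Fixpoint run L (x : seq bool) (p : state) : state :=
  match L, x with
  | l :: L', b :: x' => run L' x' (l b p)
  | _, _ => p
  end.

Lemma run_rcons L x l b p : size L = size x ->
  run (rcons L l) (rcons x b) p = l b (run L x p).
Proof. by elim: L x p => [|l' L IH] [|b' x] p //= [/IH]. Qed.

Fixpoint character (b x : seq bool) : R :=
  match b, x with
  | c :: b', a :: x' => (-1) ^+ (c && a) * character b' x'
  | _, _ => 1
  end.

Lemma coef_bitsum L b y u : size b = size L ->
  bitsum (size L) (fun x => y (run L x u) * character b x) = 2 ^+ size L * coef L b y u.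
Proof.
elim: L b u => [|l L IH] [|c b] u //=; first by rewrite mulr1 mul1r.
move=> [/[dup] sb /IH {}IH].
have E a : bitsum (size L) ((fun x => y (match x with [::] => u | b0 :: x' => run L x' (l b0 u) end) *
     match x with [::] => 1 | a0 :: x' => (-1) ^+ (c && a0) * character b x' end) \o cons a) =
   (-1) ^+ (c && a) * (2 ^+ size L * coef L b y (l a u)).
  rewrite -IH -[RHS]addr0 -[X in _ = _ + X](mul0r (bitsum (size L) (fun=> 0))) -bitsum_lin.
  by congr bitsum; apply/funext => x /=; ring.
by rewrite !E andbF andbT expr0 exprS; case: c {E sb} => /=; rewrite /hdiff /avg; field.
Qed.

Definition bits n (x : cube n) : seq bool := [seq x i | i <- enum 'I_n].

Lemma size_bits n (x : cube n) : size (bits x) = n.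
Proof. by rewrite size_map size_enum_ord. Qed.

Definition cube_cons n (b : bool) (x : cube n) : cube n.+1 :=
  [ffun i => if unlift ord0 i is Some j then x j else b].

Lemma bits_cons n b (x : cube n) : bits (cube_cons b x) = b :: bits x.
Proof.
rewrite /bits enum_ordSl /= ffunE unlift_none; congr (_ :: _).
by rewrite -map_comp; apply: eq_map => i /=; rewrite ffunE liftK.
Qed.

Lemma sum_bits n (g : seq bool -> R) : \sum_(x : cube n) g (bits x) = bitsum n g.
Proof.
elim: n g => [|n IH] g.
  rewrite (big_pred1 [ffun=> false]).
    by rewrite (size0nil (size_bits _)).
  by move=> x; apply/esym/eqP/ffunP => -[].
pose h (bx : bool * cube n) := cube_cons bx.1 bx.2.
rewrite (reindex h) /=; last first.
  exists (fun x => (x ord0, [ffun j => x (lift ord0 j)])) => [[b x] _|x _].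
    rewrite /h /= ffunE unlift_none; congr (_, _).
    by apply/ffunP => j; rewrite !ffunE liftK.
  by apply/ffunP => i; rewrite ffunE; case: unliftP => [j|] -> //=; rewrite ffunE.
rewrite -(pair_bigA _ (fun b x => g (bits (cube_cons b x)))) /= big_bool /= addrC.
by rewrite -!IH; congr (_ + _); apply: eq_bigr => x _; rewrite bits_cons.
Qed.

Lemma character_bits n (s : {set 'I_n}) (x : cube n) :
  (-1) ^+ (\sum_(i in s) (x i : nat))%N = character [seq i \in s | i <- enum 'I_n] (bits x).
Proof.
rewrite big_mkcond -big_enum /=; rewrite /bits.
elim: (enum 'I_n) => [|i e IH]; first by rewrite big_nil.
by rewrite big_cons exprD IH /=; case: (i \in s).
Qed.

Lemma sum_set_bits n (h : nat -> seq bool -> R) :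
  \sum_(s : {set 'I_n}) h #|s| [seq i \in s | i <- enum 'I_n] =
  bitsum n (fun b => h (count id b) b).
Proof.
rewrite -sum_bits (reindex (fun x : cube n => [set i | x i])) /=.
  apply: eq_bigr => x _.
  have -> : [seq i \in [set i | x i] | i <- enum 'I_n] = bits x.
    by apply: eq_map => i; rewrite inE.
  congr h; rewrite /bits count_map -sum1_card -sum1_count big_enum_cond /=.
  by apply: eq_bigl => i; rewrite inE.
exists (fun s : {set 'I_n} => [ffun i => i \in s]) => [x|s] _.
  by apply/ffunP => i; rewrite ffunE inE.
by apply/setP => i; rewrite inE ffunE.
Qed.

End Summation.

(** * Encoding a width-3 ordered program as a sequence of layers *)

Definition encode (X : finType) (v : X) : state :=
  nth None [:: Some true; Some false] (enum_rank v).

(** The default [None] of [nth] serves as the code of rank 2. *)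
Lemma encode_inj (X : finType) : (#|X| <= 3)%N -> injective (@encode X).
Proof.
move=> X3 v v' e; apply: enum_rank_inj; apply: val_inj => /=; move: e; rewrite /encode.
have := leq_trans (ltn_ord (enum_rank v)) X3; have := leq_trans (ltn_ord (enum_rank v')) X3.
by case: (nat_of_ord _) => [|[|[|?]]] //; case: (nat_of_ord _) => [|[|[|?]]].
Qed.

Section OrderedProgram.

Variables (R : realFieldType) (n : nat) (B : ordered_bp n 3).

(* The value at states that encode no vertex is irrelevant. *)
Definition bp_step (i : 'I_n) : layer := fun b p =>
  if [pick v : bp_layer B i | encode v == p] is Some v then encode (bp_trans v b)
  else p.

Definition bp_layers : seq layer := [seq bp_step i | i <- enum 'I_n].

Lemma size_bp_layers : size bp_layers = n.
Proof. by rewrite size_map size_enum_ord. Qed.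

Lemma encode_trans (i : 'I_n) (v : bp_layer B i) b :
  bp_step i b (encode v) = encode (bp_trans v b).
Proof.
rewrite /bp_step; case: pickP => [v' /eqP|/(_ v)]; last by rewrite eqxx.
by move=> /(encode_inj (bp_width B (ltnW (ltn_ord i)))) ->.
Qed.

Lemma run_bp_state (x : cube n) m (le_mn : (m <= n)%N) :
  run (take m bp_layers) (take m (bits x)) (encode (bp_start B)) =
  encode (bp_state B x le_mn).
Proof.
elim: m le_mn => [|m IH] lt_mn; first by rewrite !take0.
rewrite (take_nth (bp_step (Ordinal lt_mn))) ?size_bp_layers //.
rewrite (take_nth false) ?size_bits // run_rcons; last first.
  by rewrite !size_take size_bp_layers size_bits.
rewrite (IH (ltnW lt_mn)) /bp_layers /bits.
rewrite [nth (bp_step _) _ _](nth_map (Ordinal lt_mn)) ?size_enum_ord //.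
rewrite [nth false _ _](nth_map (Ordinal lt_mn)) ?size_enum_ord //.
have -> : nth (Ordinal lt_mn) (enum 'I_n) m = Ordinal lt_mn.
  by apply: val_inj; rewrite /= nth_enum_ord.
by rewrite encode_trans.
Qed.

Lemma run_bp_final (x : cube n) :
  run bp_layers (bits x) (encode (bp_start B)) = encode (bp_final B x).
Proof.
rewrite -(run_bp_state x (leqnn n)).
by rewrite !take_oversize ?size_bp_layers ?size_bits.
Qed.

Definition accept_vec (S : {set bp_layer B n}) : state -> R :=
  fun p => (p \in [seq encode v | v in S])%:R.

Lemma accept_final (S : {set bp_layer B n}) (x : cube n) :
  (bp_final B x \in S)%:R = accept_vec S (run bp_layers (bits x) (encode (bp_start B))).
Proof.
by rewrite run_bp_final /accept_vec mem_image //; apply: encode_inj; apply: bp_width.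
Qed.

End OrderedProgram.

(** * Fourier weight of ordered and of permuted programs *)

Section FourierGrowth.

Variable R : realType.

Lemma card_cube n : #|{: cube n}|%:R = 2 ^+ n :> R.
Proof. by rewrite card_ffun card_bool card_ord natrX. Qed.

Lemma fourier_coef n (f : cube n -> bool) (B : ordered_bp n 3)
    (S : {set bp_layer B n}) (s : {set 'I_n}) :
  (forall x, f x = (bp_final B x \in S)) ->
  fourier (fun x => (f x)%:R : R) s =
  coef (bp_layers B) [seq i \in s | i <- enum 'I_n] (accept_vec R S) (encode (bp_start B)).
Proof.
move=> fS; rewrite /fourier /unif_expectation card_cube.
have -> : \sum_(U : cube n) (f U)%:R * (-1) ^+ (\sum_(i in s) (U i : nat))%N =
    2 ^+ n * coef (bp_layers B) [seq i \in s | i <- enum 'I_n] (accept_vec R S)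
      (encode (bp_start B)) :> R.
  have sz : size [seq i \in s | i <- enum 'I_n] = size (bp_layers B).
    by rewrite size_map size_enum_ord size_bp_layers.
  have := coef_bitsum (accept_vec R S) (encode (bp_start B)) sz.
  rewrite size_bp_layers => <-.
  rewrite -sum_bits; apply: eq_bigr => x _.
  by rewrite fS accept_final character_bits.
by rewrite mulrC mulKf // expf_neq0 // pnatr_eq0.
Qed.

(** Level k enters the total weighted sum, at most 2n, with factor (t/2)^k; the other levels are
    nonnegative and dropped. *)
Lemma fourier_weight_ordered n k (f : cube n -> bool) (B : ordered_bp n 3) (J : nat) :
  (0 < n)%N -> (32 * n <= 2 ^ J)%N -> bp_computes B f ->
  fourier_weight k (fun x => (f x)%:R : R) <= 2 * n%:R * (132 * J%:R) ^+ k.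
Proof.
move=> n0 nJ [S fS].
have J0 : (0 < J)%N by case: J nJ => //; rewrite expn0 leqNgt (leq_trans _ (leq_pmulr _ n0)).
have JR : 1 <= J%:R :> R by rewrite ler1n.
have nR : 1 <= n%:R :> R by rewrite ler1n.
pose t : R := (66 * J%:R)^-1.
have t0 : 0 < t by rewrite invr_gt0 mulr_gt0 //; lra.
have t4 : t <= 1 / 4.
  by rewrite -[leLHS]mul1r ler_pdivrMr ?mulr_gt0 //; lra.
pose r : R := (16 * n%:R)^-1.
have r0 : 0 <= r by rewrite invr_ge0 mulr_ge0.
have nr : n%:R * r = 1 / 16 by rewrite /r; field; rewrite pnatr_eq0 -lt0n.
have r16 : r <= 1 / 16 by rewrite -nr ler_peMl.
have y01 : unit_vec (accept_vec R S) by move=> p; rewrite ler0n lern1 leq_b1.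
set y := accept_vec R S in y01; set u := encode (bp_start B); set L := bp_layers B.
have hr m : (1 + 11 * t) ^+ m.+1 - 1 <= 1 + r * (6 / 5) ^+ m.
  exact: (growth_bound m n0 nJ).
have Hgap L' p q : (size L' <= size L)%N -> run_op (wstep (t / 2)) L' (gap p q) y <= 2 * 1.
  rewrite size_bp_layers => L'n.
  apply: le_trans (wsum_le_rsum _ _ (ltW t0) (gap_ge0 p q) (@gap_midconvex _ p q)) _.
  have := @rsum_gap_le _ t r L' [::] p q y (ltW t0) t4 r0 r16 hr y01.
  rewrite /= expr0 !mulr1 => H; apply: le_trans H _.
  (* The product is at most 5/4 * 8/7 < 2, from r <= 1/16 and (1 + 2r)^n <= 1 / (1 - 2nr). *)
  have r20 : 0 <= 2 * r by rewrite mulr_ge0.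
  have := expr_inv_bound n r20; have -> : 1 - n%:R * (2 * r) = 7 / 8 by lra.
  have le : (1 + 2 * r) ^+ size L' <= (1 + 2 * r) ^+ n by apply: ler_weXn2l => //; lra.
  have V0 : 0 <= (1 + 2 * r) ^+ size L' by rewrite exprn_ge0 //; lra.
  by have := ler_wpM2r V0 r16; lra.
have t20 : 0 <= t / 2 by lra.
have := @wsum_value_le R (t / 2) L u y 1 t20 y01 Hgap.
rewrite wsum_coef size_bp_layers mulr1.
rewrite -(@sum_set_bits R n (fun m b => (t / 2) ^+ m * `|coef L b y u|)) => le.
have {}le : fourier_weight k (fun x => (f x)%:R : R) * (t / 2) ^+ k <= 2 * n%:R.
  apply: le_trans (_ : 1 + n%:R * (t / 2) <= _); last first.
    have n0R : 0 <= n%:R :> R by [].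
    by have := ler_wpM2l n0R t4; lra.
  apply: le_trans le; rewrite /fourier_weight mulr_suml.
  rewrite [leRHS](bigID (fun s : {set 'I_n} => #|s| == k)) /=.
  rewrite -[leLHS]addr0 lerD //; last by apply: sumr_ge0 => s _; rewrite mulr_ge0 ?exprn_ge0.
  by apply: ler_sum => s /eqP <-; rewrite mulrC (fourier_coef _ fS).
rewrite -ler_pdivlMr ?exprn_gt0 // in le; last by lra.
apply: le_trans le _; rewrite -exprVn /t.
by rewrite (_ : (_ / 2)^-1 = 132 * J%:R) //; field; rewrite pnatr_eq0 -lt0n.
Qed.

(** The coefficient of f at the image of s under [pi] is that of f' at s. *)
Lemma fourier_weight_permute n k (f f' : cube n -> bool) (pi : 'S_n) :
  (forall x, f x = f' (permute_coords pi x)) ->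
  fourier_weight k (fun x => (f x)%:R : R) = fourier_weight k (fun x => (f' x)%:R : R).
Proof.
move=> ff'; rewrite /fourier_weight.
rewrite (reindex (fun s : {set 'I_n} => [set pi i | i in s])) /=; last first.
  exists (fun s : {set 'I_n} => pi @^-1: s) => s _; apply/setP => i.
    by rewrite inE mem_imset //; apply: perm_inj.
  rewrite -[i](permKV pi) mem_imset ?inE //; exact: perm_inj.
apply: eq_big => s; first by rewrite card_imset //; apply: perm_inj.
move=> _; rewrite /fourier /unif_expectation; congr `|_ / _|.
rewrite [RHS](reindex (permute_coords pi)) /=; last first.
  exists (permute_coords pi^-1%g) => x _; apply/ffunP => i; rewrite !ffunE.
    by rewrite permKV.
  by rewrite permK.
apply: eq_bigr => x _; rewrite ff' big_imset /=; last by move=> ? ? _ _; apply: perm_inj.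
by congr (_ * _ ^+ _); apply: eq_bigr => i _; rewrite ffunE.
Qed.

(** The power 2 ^ [up_log 2 n] is at most 2n for n > 1 and equals 1 for n = 1, so below 3n; the 5 is
    absorbed by 1 <= log2 (3n). *)
Lemma up_log_le_log2 n : (0 < n)%N -> (up_log 2 n + 5)%:R <= 6 * log2 (3 * n%:R) :> R.
Proof.
move=> n0; have nR : 1 <= n%:R :> R by rewrite ler1n.
have l2 : 0 < ln 2 :> R by rewrite ln_gt0 // ltr1n.
have log_ge m : (2 ^ m <= 3 * n)%N -> m%:R <= log2 (3 * n%:R) :> R.
  move=> le; rewrite /log2 ler_pdivlMr // [leLHS]mulr_natl -lnXn ?ltr0n //.
  rewrite ler_ln ?posrE ?exprn_gt0 // ?mulr_gt0 //; last by lra.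
  by rewrite -natrX -natrM ler_nat.
have h1 := log_ge 1%N (leq_trans (isT : (2 <= 3 * 1)%N) (leq_mul (leqnn 3) n0)).
have h2 : (up_log 2 n)%:R <= log2 (3 * n%:R) :> R.
  apply: log_ge; have [n1|n1] := leqP n 1; last first.
    have /andP[lt _] := up_log_bounds (isT : (1 < 2)%N) n1.
    have := up_log_gt0 2 n; rewrite n1 => /= u0.
    rewrite -(prednK u0) expnS (leq_trans (_ : _ <= 2 * n)%N) ?leq_mul2l ?leq_mul2r ?orbT //.
    by rewrite ltnW.
  by rewrite (@anti_leq n 1) ?n1.
by rewrite natrD; lra.
Qed.

End FourierGrowth.

Theorem theorem3p1 (R : realType) :
  exists C : R, forall (n : nat) (f : cube n -> bool),
    computed_by_robp 3 f ->
    forall k : nat, (1 <= k <= n)%N ->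
      fourier_weight k (fun x => (f x)%:R : R)
        <= 8 * n%:R ^+ 2 * (C * log2 (3 * n%:R)) ^+ k.
Proof.
(* 792 = 132 * 6: the base is 132 J, and J is at most 6 log2 (3n). *)
exists 792 => n f [f' [pi [[B Bf'] ff']]] k /andP[k1 kn].
have n0 : (0 < n)%N := leq_trans k1 kn.
have nR : 1 <= n%:R :> R by rewrite ler1n.
rewrite (fourier_weight_permute R k ff').
pose J := (up_log 2 n + 5)%N.
have nJ : (32 * n <= 2 ^ J)%N by rewrite expnD mulnC leq_mul // up_logP.
apply: le_trans (fourier_weight_ordered R k n0 nJ Bf') _.
have JL : J%:R <= 6 * log2 (3 * n%:R) :> R := up_log_le_log2 R n0.
have J0 : 0 <= J%:R :> R by [].
apply: ler_pM; rewrite ?mulr_ge0 ?exprn_ge0 ?mulr_ge0 //.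
  by have := ler_wpM2l (ler0n R n) nR; rewrite expr2; lra.
by apply: lerXn2r; rewrite ?nnegrE; lra.
Qed.
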